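(* Let $K$ be a field, $S=K[x_1,\dots,x_n]$, and let $I\subset S$ be a nonzero monomial ideal such that for every minimal monomial generator $ut^q$ of the symbolic Rees algebra $\mathcal{R}_s(I)$ with $q>0$ and $u\in S$ we have $\deg(u)\le q+\omega(I)-1$. Then $d(I,k)=\omega(I)k$ for all $k\ge1$.
   Context: $\omega(I)$ is the largest degree of a minimal generator of $I$. The $k$th symbolic power is $I^{(k)}=\bigcap_{P\in\mathrm{Ass}(I)}(I^kS_P\cap S)$, with $\mathrm{Ass}(I)=\mathrm{Ass}(S/I)$. The symbolic Rees algebra $\mathcal{R}_s(I)=\bigoplus_{k\ge0}I^{(k)}t^k\subset S[t]$ of a monomial ideal is (known to be) a finitely generated $K$-algebra, with minimal monomial generators $x_1,\dots,x_n,u_1t^{q_1},\dots,u_mt^{q_m}$, where $u_j\in S$ are monomials and $q_j>0$. For $k\ge1$, $d(I,k)=\max\{\sum_{s=1}^mc_s\deg(u_s):(c_1,\dots,c_m)\in\mathbb{Z}_{\ge0}^m,\ c_1q_1+\dots+c_mq_m\le k\}$. *)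

(* Defs.v *)
From mathcomp Require Import all_boot all_order all_algebra.
From mathcomp Require Import mpoly.
From Stdlib Require Import ClassicalEpsilon.
Set Implicit Arguments.
Unset Strict Implicit.
Unset Printing Implicit Defensive.
Import GRing.Theory.
Local Open Scope ring_scope.

Definition is_max (E : nat -> Prop) (m : nat) : Prop :=
  E m /\ forall e, E e -> (e <= m)%N.

(* Unspecified when E has no greatest element. *)
Definition nat_max (E : nat -> Prop) : nat := epsilon (inhabits 0%N) (is_max E).

(* G is irredundant for the property [gen] (e.g. generating a given object). *)
Definition minimal_set (T : Type) (gen : (T -> Prop) -> Prop) (G : T -> Prop) :=
  gen G /\
  forall H : T -> Prop, (forall x, H x -> G x) -> gen H -> forall x, G x -> H x.

Section Ideals.
Variable R : comNzRingType.
Implicit Types (I J P A : R -> Prop) (k : nat).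

Definition is_ideal I : Prop :=
  [/\ I 0, forall f g, I f -> I g -> I (f + g) & forall r f, I f -> I (r * f)].

Definition prime_ideal P : Prop :=
  [/\ is_ideal P, ~ P 1 & forall f g, P (f * g) -> P f \/ P g].

Definition ideal_gen A : R -> Prop :=
  fun f => forall J, is_ideal J -> (forall a, A a -> J a) -> J f.

Definition ideal_mul I J : R -> Prop :=
  ideal_gen (fun h => exists f g, [/\ I f, J g & h = f * g]).

Fixpoint ideal_pow I k : R -> Prop :=
  if k is k'.+1 then ideal_mul I (ideal_pow I k') else fun=> True.

(* P is in Ass(R/I): a prime which is the annihilator of the class of some f. *)
Definition assoc_prime I P : Prop :=
  prime_ideal P /\ exists f, forall g, P g <-> I (g * f).

End Ideals.

Section SymbolicPowers.
Variable R : idomainType.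
Implicit Types (I J P : R -> Prop) (k : nat).

(* The extension J R_P, with the localization R_P taken inside Frac(R). *)
Definition loc_ideal J P : {fraction R} -> Prop :=
  fun z => exists f s, [/\ J f, ~ P s & z = tofrac f / tofrac s].

(* If I is the unit ideal then Ass(I) is empty and the intersection is R. *)
Definition symb_pow I k : R -> Prop :=
  fun g => forall P, assoc_prime I P -> loc_ideal (ideal_pow I k) P (tofrac g).

(* The symbolic Rees algebra, as a subset of R[t]. *)
Definition symb_rees I : {poly R} -> Prop :=
  fun p => forall k, symb_pow I k p`_k.

End SymbolicPowers.

Section Monomial.
Variables (K : fieldType) (n : nat).
Local Notation S := {mpoly K[n]}.
Local Notation mon := 'X_{1..n}.
Implicit Types (I : S -> Prop) (u : mon) (k q e : nat).

Definition mon_ideal_gen (M : mon -> Prop) : S -> Prop :=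
  ideal_gen (fun f => exists2 u, M u & f = 'X_[u]).

Definition gens_ideal I (M : mon -> Prop) : Prop :=
  forall f, mon_ideal_gen M f <-> I f.

Definition monomial_ideal I : Prop := exists M, gens_ideal I M.

Definition nonzero_ideal I : Prop := exists2 f, I f & f != 0.

(* A monomial ideal has exactly one irredundant set of monomial generators;
   likewise for the monomial algebra in [rees_min_gen] below. *)
Definition min_gen I u : Prop :=
  exists2 M, minimal_set (gens_ideal I) M & M u.

Definition omega I : nat :=
  nat_max (fun e => exists2 u, min_gen I u & e = mdeg u).

Definition is_subalg (B : {poly S} -> Prop) : Prop :=
  [/\ forall c : K, B (c%:MP%:P),
      forall p r, B p -> B r -> B (p + r) &
      forall p r, B p -> B r -> B (p * r)].

(* The pair (u, q) stands for the monomial u t^q of S[t]. *)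
Definition mon_subalg_gen (G : mon * nat -> Prop) : {poly S} -> Prop :=
  fun p => forall B, is_subalg B ->
    (forall g, G g -> B ('X_[g.1] *: 'X^(g.2))) -> B p.

Definition gens_rees I (G : mon * nat -> Prop) : Prop :=
  forall p, mon_subalg_gen G p <-> symb_rees I p.

Definition rees_min_gen I (g : mon * nat) : Prop :=
  exists2 G, minimal_set (gens_rees I) G & G g.

(* The exponent vectors (c_1, ..., c_m) are the finitely supported families c
   on the minimal generators u t^q with q > 0, with support inside s; no
   enumeration u_1 t^{q_1}, ..., u_m t^{q_m} has to be chosen. *)
Definition d_sum I k e : Prop :=
  exists (s : seq (mon * nat)) (c : mon * nat -> nat),
    [/\ uniq s,
        forall g, g \in s -> rees_min_gen I g /\ (0 < g.2)%N,
        (\sum_(g <- s) c g * g.2 <= k)%N &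
        e = (\sum_(g <- s) c g * mdeg g.1)%N].

Definition d I k : nat := nat_max (d_sum I k).

End Monomial.

(* Main.v *)
Require Import Defs.
From mathcomp Require Import all_boot all_order all_algebra.
From mathcomp Require Import mpoly.
From mathcomp Require Import zify ring.
From Stdlib Require Import ClassicalEpsilon.

(** Write w for [omega I].  Everything reduces to two facts about a minimal
    generator u t^q of the symbolic Rees algebra with q > 0.

    - deg u <= w q.  If w > 0, the hypothesis gives
      deg u <= q + w - 1 <= w q, because (w - 1) (q - 1) >= 0.  If w = 0 then I
      is the unit ideal, its Rees algebra is the whole ring S[t], and the only
      minimal generator with q > 0 is t itself.  Summing, every admissible
      family c has weighted degree at most w k.
    - The value w k is reached.  A minimal generator u of I of degree w gives a
      minimal generator u t of the Rees algebra, and it can be used k times.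

    The remaining work is to control the minimal generators.  A monomial
    algebra is the span of a submonoid E of the monomials u t^q, and its unique
    irredundant set of monomial generators is the set of irreducible elements
    of E ([rees_min_genE]).  For this description to apply, the symbolic powers
    must be spanned by monomials.  By definition g lies in I^(k) when, for each
    associated prime P, some s outside P satisfies s g \in I^k; the radical of
    the colon ideal (I^k : g) turns out to be spanned by monomials, so s can be
    replaced by a monomial outside P ([monomial_colon_witness]).

    That u t is irreducible for a minimal generator u of I rests on I^(1) = I
    ([symb_pow1]): if g is not in I, an associated prime of I contains the
    colon ideal (I : g).  Its existence uses that S is Noetherian, which is
    deduced from Dickson's lemma by comparing leading monomials.  Dickson's
    lemma also shows that the degrees of the minimal generators of I are
    bounded, so that w is attained. *)

Set Implicit Arguments.
Unset Strict Implicit.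
Unset Printing Implicit Defensive.
Import Order.TTheory GRing.Theory.

(** * Greatest elements and least generating sets *)

Section Extremal.

Lemma bounded_is_max (E : nat -> Prop) b :
  (exists e, E e) -> (forall e, E e -> e <= b) -> exists m, is_max E m.
Proof.
elim: b => [|b IH] [e Ee] le_b.
  by exists e; split=> // e' /le_b; rewrite leqn0 => /eqP->.
have [Eb|nEb] := classic (E b.+1); first by exists b.+1.
apply: IH; first by exists e.
move=> e' Ee'; have := le_b _ Ee'; rewrite leq_eqVlt => /orP[/eqP e'E|//].
by case: nEb; rewrite -e'E.
Qed.

Lemma nat_max_eq (E : nat -> Prop) m : is_max E m -> nat_max E = m.
Proof.
move=> maxm; have [Em lem] := maxm.
have [En len] : is_max E (nat_max E) by apply: epsilon_spec; exists m.
by apply/eqP; rewrite eqn_leq lem ?len.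
Qed.

(** When some generating set lies in every other one, it is the only minimal
    one.  Both the generators of a monomial ideal and those of a monomial
    algebra are of this kind. *)
Lemma minimal_set_least (T : Type) (gen : (T -> Prop) -> Prop) (D : T -> Prop) :
  gen D -> (forall H, gen H -> forall x, D x -> H x) ->
  forall x, (exists2 G, minimal_set gen G & G x) <-> D x.
Proof.
move=> genD leastD x; split=> [[G [genG minG] Gx]|Dx].
  by apply: (minG D) => // y; apply: leastD.
by exists D => //; split=> // H _ /leastD.
Qed.

End Extremal.

(** * Dickson's lemma *)

Section Dickson.

Lemma tail_argmin (f : nat -> nat) N :
  exists k, N <= k /\ forall j, N <= j -> f k <= f j.
Proof.
(* Induction on a bound v for a value reached in the tail. *)
suff min_below v k : N <= k -> f k <= v ->
    exists k, N <= k /\ forall j, N <= j -> f k <= f j.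
  exact: (min_below (f N) N).
elim: v k => [|v IH] k leNk lefk.
  by exists k; split=> // j _; apply: leq_trans lefk _.
have [[j [leNj lefj]]|nlow] := classic (exists j, N <= j /\ f j <= v).
  exact: IH leNj lefj.
exists k; split=> // j leNj; apply: leq_trans lefk _.
by rewrite ltnNge; apply/negP => lefj; apply: nlow; exists j.
Qed.

(** Each term of the subsequence is a place where the rest of the sequence
    attains its minimum. *)
Lemma nondecreasing_subsequence (f : nat -> nat) :
  exists phi : nat -> nat, {homo phi : i j / i < j} /\
    {homo (fun i => f (phi i)) : i j / i <= j}.
Proof.
pose argmin N := proj1_sig (constructive_indefinite_description _ (tail_argmin f N)).
have argminP N : N <= argmin N /\ forall j, N <= j -> f (argmin N) <= f j.
  by rewrite /argmin; case: constructive_indefinite_description.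
pose phi i := iter i (fun N => argmin N.+1) (argmin 0).
have phiS i : phi i < phi i.+1 by case: (argminP (phi i).+1).
exists phi; split; first exact: (homo_ltn ltn_trans phiS).
apply: (homo_leq leqnn leq_trans) => -[|i].
  exact: (argminP 0).2.
exact: (argminP (phi i).+1).2 _ (ltn_trans (phiS i) (phiS i.+1)).
Qed.

(** Successive extractions make the coordinates nondecreasing one at a time. *)
Lemma dickson n (u : nat -> 'X_{1..n}) : exists i j, i < j /\ (u i <= u j)%MM.
Proof.
suff [phi [phi_lt phi_le]] : exists phi : nat -> nat, {homo phi : i j / i < j} /\
    forall c, c \in enum 'I_n -> {homo (fun i => u (phi i) c) : i j / i <= j}.
  exists (phi 0), (phi 1); split; first exact: phi_lt.
  by apply/mnm_lepP => c; apply: phi_le; rewrite ?mem_enum.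
elim: (enum 'I_n) => [|c s [phi [phi_lt phi_le]]]; first by exists id; split.
have [psi [psi_lt psi_le]] := nondecreasing_subsequence (fun i => u (phi i) c).
exists (phi \o psi); split=> [i j ltij|c']; first exact: phi_lt (psi_lt _ _ ltij).
rewrite inE => /orP[/eqP->|c's] i j leij; first exact: psi_le.
apply: phi_le c's _ _ _; move: leij; rewrite leq_eqVlt => /orP[/eqP->//|].
by move/psi_lt/ltnW.
Qed.

(** An antichain with unbounded degrees would contain a sequence of strictly
    increasing degrees, in which two terms are comparable. *)
Lemma antichain_mdeg_bounded n (A : 'X_{1..n} -> Prop) :
  (forall u v, A u -> A v -> (u <= v)%MM -> u = v) ->
  exists b, forall u, A u -> mdeg u <= b.
Proof.
move=> anti; apply: NNPP => unbounded.
have big b : exists u, A u /\ b < mdeg u.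
  apply: NNPP => small; apply: unbounded; exists b => u Au.
  by rewrite leqNgt; apply/negP => ltbu; apply: small; exists u.
pose pick b := proj1_sig (constructive_indefinite_description _ (big b)).
have pickP b : A (pick b) /\ b < mdeg (pick b).
  by rewrite /pick; case: constructive_indefinite_description.
pose u i := iter i (fun v => pick (mdeg v)) (pick 0).
have Au i : A (u i) by case: i => [|i]; [exact: (pickP 0).1 | exact: (pickP _).1].
have deg_u : {homo (fun i => mdeg (u i)) : i j / i < j}.
  by apply: (homo_ltn ltn_trans) => i; exact: (pickP _).2.
have [i [j [ltij leu]]] := dickson u.
by have := deg_u _ _ ltij; rewrite (anti _ _ (Au i) (Au j) leu) ltnn.
Qed.

End Dickson.

(** * Ideals, their powers and radicals of colon ideals *)

Section IdealTheory.
Local Open Scope ring_scope.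
Variable R : comNzRingType.
Implicit Types (J L P : R -> Prop).

Lemma idealMr J x y : is_ideal J -> J x -> J (x * y).
Proof. by case=> _ _ JM Jx; rewrite mulrC; apply: JM. Qed.

Lemma idealB J x y : is_ideal J -> J x -> J y -> J (x - y).
Proof.
by move=> [_ JD JM] Jx Jy; apply: JD => //; rewrite -mulN1r; apply: JM.
Qed.

Lemma ideal_sum J (T : eqType) (s : seq T) (P : pred T) (F : T -> R) :
  is_ideal J -> (forall i, i \in s -> P i -> J (F i)) ->
  J (\sum_(i <- s | P i) F i).
Proof.
move=> [J0 JD _] JF; rewrite big_seq_cond; elim/big_ind: _ => //.
by move=> i /andP[]; apply: JF.
Qed.

Lemma ideal_gen_is_ideal (A : R -> Prop) : is_ideal (ideal_gen A).
Proof.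
split=> [J [J0 _ _] _ //|f g genf geng J idJ AJ|r f genf J idJ AJ].
  by have [_ JD _] := idJ; apply: JD; [apply: genf | apply: geng].
by have [_ _ JM] := idJ; apply: JM; apply: genf.
Qed.

Lemma ideal_pow_is_ideal J k : is_ideal (ideal_pow J k).
Proof. by case: k => [|k] /=; [split | apply: ideal_gen_is_ideal]. Qed.

Lemma ideal_mulI J L f g : J f -> L g -> ideal_mul J L (f * g).
Proof. by move=> Jf Lg L' _; apply; exists f, g. Qed.

Lemma ideal_powD J k l f g :
  ideal_pow J k f -> ideal_pow J l g -> ideal_pow J (k + l) (f * g).
Proof.
elim: k f g => [|k IH] f g.
  by move=> _ Jg; case: (ideal_pow_is_ideal J l) => _ _; apply.
rewrite addSn => Jf Jg; have [J0 JD JM] := ideal_pow_is_ideal J (k + l).+1.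
apply: (Jf (fun f => ideal_pow J (k + l).+1 (f * g))).
  split=> [|x y Jx Jy|r x Jx]; rewrite ?mul0r ?mulrDl -?mulrA //.
    exact: JD.
  exact: JM.
move=> _ [x [y [Jx Jy ->]]]; rewrite -mulrA; apply: ideal_mulI => //.
exact: IH.
Qed.

Lemma prime_idealX P x N : prime_ideal P -> P (x ^+ N) -> P x.
Proof.
move=> [_ P1 PM]; elim: N => [|N IH]; first by rewrite expr0.
by rewrite exprS => /PM[].
Qed.

(** This is the radical of (J : g).  In the expansion of (x + y)^(N + M) every
    term is a multiple of x^N or of y^M. *)
Lemma radical_colon_is_ideal J g : is_ideal J ->
  is_ideal (fun a => exists N, J (a ^+ N * g)).
Proof.
move=> idJ; have [J0 JD JM] := idJ.
split=> [|x y [N JN] [M JM']|r x [N JN]].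
- by exists 1; rewrite expr1 mul0r.
- exists (N + M)%N; rewrite exprDn mulr_suml; apply: ideal_sum => // i _ _.
  rewrite mulrnAl -mulr_natl; apply: (JM).
  have [leMi|ltiM] := leqP M i.
    have -> : y ^+ i = y ^+ (i - M) * y ^+ M by rewrite -exprD subnK.
    by rewrite -!mulrA; apply: (JM); apply: JM.
  have -> : x ^+ (N + M - i) = x ^+ (M - i) * x ^+ N.
    by rewrite -exprD; congr (_ ^+ _); lia.
  by rewrite mulrAC mulrC -mulrA; apply: (JM); apply: JM.
- by exists N; rewrite exprMn -mulrA; apply: JM.
Qed.

End IdealTheory.

(** * Ideals spanned by monomials *)

Section MonomialIdeals.
Local Open Scope ring_scope.
Variables (K : fieldType) (n : nat).
Local Notation S := {mpoly K[n]}.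
Local Notation mon := 'X_{1..n}.
Implicit Types (I J P T : S -> Prop) (u v m : mon).

(** For an ideal this is equivalent to [monomial_ideal]; it refers to no set of
    generators, hence passes easily to powers and symbolic powers. *)
Definition has_monomials J := forall f m, J f -> m \in msupp f -> J 'X_[m].

Lemma ideal_of_msupp J f : is_ideal J ->
  (forall m, m \in msupp f -> J 'X_[m]) -> J f.
Proof.
move=> idJ Jm; have [_ _ JM] := idJ; rewrite [f]mpolyE.
by apply: ideal_sum => // m mf _; rewrite -mul_mpolyC; apply/JM/Jm.
Qed.

Lemma ideal_lem J u v : is_ideal J -> (u <= v)%MM -> J 'X_[u] -> J 'X_[v].
Proof.
by move=> [_ _ JM] leuv Ju; rewrite -(submK leuv) mpolyXD; apply: JM.
Qed.

Lemma upset_is_ideal (U : mon -> Prop) :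
  (forall u v, (u <= v)%MM -> U u -> U v) ->
  is_ideal (fun f : S => forall m, m \in msupp f -> U m).
Proof.
move=> upU; split=> [m|f g Uf Ug m|r f Uf m].
- by rewrite -mpolyC0 msupp0.
- by move/msuppD_le; rewrite mem_cat => /orP[/Uf|/Ug].
- move/msuppM_le/allpairsP=> [[a b] /= [_ bf ->]].
  exact: upU (lem_addl _ _) (Uf _ bf).
Qed.

(** Polynomials whose monomials lie in a given set closed under multiples form
    an ideal, so the ideal generated by M is not larger than expected. *)
Lemma mon_ideal_genP (M : mon -> Prop) (f : S) :
  mon_ideal_gen M f <->
  (forall m, m \in msupp f -> exists2 u, M u & (u <= m)%MM).
Proof.
split=> [genf|Mf].
  apply: (genf (fun f : S => forall m, m \in msupp f ->
                  exists2 u, M u & (u <= m)%MM)).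
    apply: (upset_is_ideal (U := fun m => exists2 u, M u & (u <= m)%MM)).
    by move=> a b leab [w Mw lewa]; exists w => //; apply: lepm_trans leab.
  by move=> _ [u Mu ->] m /mem_msuppXP <-; exists u => //; apply: lepm_refl.
have idM : is_ideal (@mon_ideal_gen K n M) by apply: ideal_gen_is_ideal.
apply: ideal_of_msupp => // m /Mf [u Mu leum]; apply: ideal_lem leum _ => //.
by move=> J _; apply; exists u.
Qed.

Lemma monomial_ideal_is_ideal I : monomial_ideal I -> is_ideal I.
Proof.
case=> M genM; have [M0 MD MM] : is_ideal (@mon_ideal_gen K n M).
  exact: ideal_gen_is_ideal.
split; first exact/genM.
  by move=> f g /genM Mf /genM Mg; apply/genM; apply: MD.
by move=> r f /genM Mf; apply/genM; apply: MM.
Qed.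

Lemma monomial_ideal_has_monomials I : monomial_ideal I -> has_monomials I.
Proof.
case=> M genM f m /genM/mon_ideal_genP Mf mf; apply/genM/mon_ideal_genP.
by move=> m' /mem_msuppXP <-; apply: Mf.
Qed.

(** The polynomials all of whose monomials lie in I^(k+1) form an ideal which
    contains the products generating I^(k+1). *)
Lemma ideal_pow_has_monomials I k :
  has_monomials I -> has_monomials (ideal_pow I k).
Proof.
move=> monI; elim: k => [//|k IH] f m Jf; move: m.
have idJ := ideal_pow_is_ideal I k.+1.
apply: (Jf (fun f : S => forall m, m \in msupp f -> ideal_pow I k.+1 'X_[m])).
  apply: (upset_is_ideal (U := fun m => ideal_pow I k.+1 'X_[m])).
  by move=> a b leab; apply: ideal_lem.
move=> _ [a [b [Ia Jb ->]]] m /msuppM_le/allpairsP[[u v] /= [ua vb ->]].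
by rewrite mpolyXD; apply: ideal_mulI; [apply: monI ua | apply: IH vb].
Qed.

Lemma msupp_rem_lead_size (f : S) : f != 0 ->
  (size (msupp (f - f@_(mlead f) *: 'X_[mlead f])) < size (msupp f))%N.
Proof.
move=> nzf; rewrite (perm_size (msupp_rem f (mlead f))) size_rem ?mlead_supp //.
by rewrite ltn_predL lt0n size_eq0 msupp_eq0.
Qed.

(** The leading term of an element can be removed without leaving the ideal,
    so all its monomials are reached one after the other. *)
Lemma lead_has_monomials T : is_ideal T ->
  (forall a, T a -> a != 0 -> T 'X_[mlead a]) -> has_monomials T.
Proof.
move=> idT leadT f; have [N leN] := ubnP (size (msupp f)).
elim: N f leN => // N IH f leN m Tf mf.
have nzf : f != 0 by apply: contraTneq mf => ->; rewrite -mpolyC0 msupp0.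
have Tlead := leadT f Tf nzf.
have [->//|m_lead] := eqVneq m (mlead f).
apply: (IH (f - f@_(mlead f) *: 'X_[mlead f])).
- exact: leq_trans (msupp_rem_lead_size nzf) leN.
- apply: idealB => //; rewrite -mul_mpolyC; by case: idT => _ _; apply.
- by rewrite (perm_mem (msupp_rem _ _)) mem_rem_uniq ?msupp_uniq // inE m_lead.
Qed.

(** The leading monomial of a g is in J, hence x = X^(mlead a) multiplies the
    leading term t of g into J.  Then a still multiplies x (g - t) into J, and
    x (g - t) has fewer terms than g; one more power of x accounts for t.
    This is the classical argument for the homogeneity of associated primes,
    and it avoids torus actions, which are useless over a finite field. *)
Lemma mlead_power_annihilates J (a g : S) : is_ideal J -> has_monomials J -> a != 0 ->
  J (a * g) -> exists N, J ('X_[mlead a] ^+ N * g).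
Proof.
move=> idJ monJ nza; have [J0 JD JM] := idJ.
have [N leN] := ubnP (size (msupp g)); elim: N g leN => // N IH g leN Jag.
have [g0|nzg] := eqVneq g 0; first by exists 0%N; rewrite g0 mulr0.
set x := 'X_[mlead a]; set t := g@_(mlead g) *: 'X_[mlead g].
have Jxt : J (x * t).
  rewrite /x /t -mul_mpolyC mulrCA -mpolyXD; apply: JM; apply: monJ Jag _.
  by rewrite -mleadM // mlead_supp // mulf_neq0.
have [||M JM'] := IH (x * (g - t)).
- rewrite mulrC (perm_size (msuppMX _ _)) size_map.
  exact: leq_trans (msupp_rem_lead_size nzg) leN.
- rewrite mulrCA mulrBr mulrBr; apply: idealB => //.
    exact: JM.
  by rewrite mulrCA; apply: (JM).
exists M.+1.
have -> : x ^+ M.+1 * g = x ^+ M * (x * (g - t)) + x ^+ M * (x * t).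
  by rewrite exprS; ring.
by apply: JD => //; apply: JM.
Qed.

(** The radical T of (J : g) contains the leading monomial of each of its
    elements, so it is spanned by monomials.  As s is in T but not in P, one of
    its monomials m is in T and not in P; a power of m is the witness. *)
Lemma monomial_colon_witness J P s g : is_ideal J -> has_monomials J ->
  prime_ideal P -> ~ P s -> J (s * g) -> exists2 m, ~ P 'X_[m] & J ('X_[m] * g).
Proof.
move=> idJ monJ primeP nPs Jsg; have [idP _ _] := primeP.
pose T a := exists N, J (a ^+ N * g).
have idT : is_ideal T by apply: radical_colon_is_ideal.
have monT : has_monomials T.
  apply: lead_has_monomials => // a [N JaN] nza.
  have [M] := mlead_power_annihilates idJ monJ (expf_neq0 N nza) JaN.
  by rewrite mleadX // -mpolyXn -exprM => JaNM; exists (N * M)%N.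
have Ts : T s by exists 1%N; rewrite expr1.
have [m [ms nPm]] : exists m, m \in msupp s /\ ~ P 'X_[m].
  apply: NNPP => noP; apply: nPs; apply: ideal_of_msupp => // m ms.
  by apply: NNPP => nPm; apply: noP; exists m.
have [N JmN] := monT _ _ Ts ms.
exists (m *+ N)%MM; rewrite -mpolyXn //.
by move/(prime_idealX primeP).
Qed.

End MonomialIdeals.

(** * Noetherianity and associated primes *)

Section Noetherian.
Local Open Scope ring_scope.
Variables (K : fieldType) (n : nat).
Local Notation S := {mpoly K[n]}.
Implicit Types (I J P : S -> Prop).

Definition leads J (u : 'X_{1..n}) := exists f, [/\ J f, f != 0 & mlead f = u].

Lemma leads_lem J u v : is_ideal J -> (u <= v)%MM -> leads J u -> leads J v.
Proof.
move=> [_ _ JM] leuv [f [Jf nzf lead_f]]; exists ('X_[v - u] * f).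
have nzX : 'X_[v - u] != 0 :> S by rewrite -msupp_eq0 msuppX.
split; [exact: JM | exact: mulf_neq0 | by rewrite mleadM // mleadXm lead_f submK].
Qed.

(** Division with remainder, one step at a time: subtracting from f an element
    of J with the same leading term lowers the leading monomial. *)
Lemma leads_sub J L : is_ideal J -> is_ideal L -> (forall f, J f -> L f) ->
  (forall u, leads L u -> leads J u) -> forall f, L f -> J f.
Proof.
move=> idJ idL JL leadLJ; have [J0 JD JM] := idJ; have [_ _ LM] := idL.
elim/mleadrect => f IH Lf.
have [->//|nzf] := eqVneq f 0.
have [h [Jh nzh lead_h]] : leads J (mlead f) by apply: leadLJ; exists f.
have nzc : mleadc h != 0 by rewrite mleadc_eq0.
pose t := (mleadc f / mleadc h)%:MP * h.
have Jt : J t by apply: JM.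
have [/eqP|nzq] := eqVneq (f - t) 0; first by rewrite subr_eq0 => /eqP->.
rewrite -(subrK t f); apply: JD => //; apply: IH; last by apply: idealB => //; apply: JL.
rewrite lt_neqAle; apply/andP; split.
  apply: contraNneq nzq => lead_q; rewrite -mleadc_eq0 lead_q.
  by rewrite mcoeffB mcoeffCM -lead_h divfK // subrr.
apply: le_trans (mleadB_le _ _) _; rewrite leUx lexx /=.
by rewrite /t mul_mpolyC (le_trans (mleadZ_le _ _)) // lead_h.
Qed.

(** Otherwise there is a strictly increasing chain of ideals; each step brings
    a new leading monomial u i, and by Dickson's lemma some u j is a multiple
    of an earlier u i, so it was not new. *)
Lemma maximal_ideal_exists (F : (S -> Prop) -> Prop) :
  (exists J, F J) -> (forall J, F J -> is_ideal J) ->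
  exists2 J, F J & forall L, F L -> (forall f, J f -> L f) -> forall f, L f -> J f.
Proof.
move=> [J0 FJ0] idF; apply: NNPP => nomax.
have grow (J : {J | F J}) : exists L : {L | F L},
    (forall f, sval J f -> sval L f) /\ exists u, leads (sval L) u /\ ~ leads (sval J) u.
  case: J => J FJ /=; apply: NNPP => stuck; apply: nomax; exists J => // L FL JL.
  apply: leads_sub => //; [exact: idF | exact: idF | move=> u Lu].
  apply: NNPP => nJu; apply: stuck; exists (exist _ L FL); split=> //.
  by exists u.
pose next c := proj1_sig (constructive_indefinite_description _ (grow c)).
have nextP c : (forall f, sval c f -> sval (next c) f) /\
    exists u, leads (sval (next c)) u /\ ~ leads (sval c) u.
  by rewrite /next; case: constructive_indefinite_description.
pose chain i := iter i next (exist _ J0 FJ0).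
have chain_sub i j f : (i <= j)%N -> sval (chain i) f -> sval (chain j) f.
  move/subnK <-; elim: (j - i)%N => // k IH /IH.
  by exact: (nextP _).1.
have new i : exists u, leads (sval (chain i.+1)) u /\ ~ leads (sval (chain i)) u.
  exact: (nextP (chain i)).2.
pose u i := proj1_sig (constructive_indefinite_description _ (new i)).
have uP i : leads (sval (chain i.+1)) (u i) /\ ~ leads (sval (chain i)) (u i).
  by rewrite /u; case: constructive_indefinite_description.
have [i [j [ltij leij]]] := dickson u.
have [_ nuj] := uP j; apply: nuj.
apply: leads_lem leij _; first exact: idF (svalP _).
have [[f [If nzf <-]] _] := uP i; exists f; split=> //.
exact: chain_sub ltij If.
Qed.

(** Among the colon ideals (I : h g) with h g outside I, a maximal one is prime:
    if a is not in (I : h g), then (I : a h g) is in the family and contains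
    (I : h g), so both are equal. *)
Lemma assoc_prime_exists I g : is_ideal I -> ~ I g ->
  exists2 P, assoc_prime I P & forall s, I (s * g) -> P s.
Proof.
move=> idI nIg; have [I0 ID IM] := idI.
pose F J := exists2 h, ~ I (h * g) & forall s, J s <-> I (s * (h * g)).
have [||P [h nIhg PE] maxP] := @maximal_ideal_exists F.
- by exists (fun s => I (s * g)), 1 => [|s]; rewrite mul1r.
- move=> J [h _ JE]; split=> [|x y|r x].
  + by apply/JE; rewrite mul0r.
  + by move=> /JE Jx /JE Jy; apply/JE; rewrite mulrDl; apply: ID.
  + by move=> /JE Jx; apply/JE; rewrite -mulrA; apply: IM.
exists P; last by move=> s Isg; apply/PE; rewrite mulrCA; apply: IM.
split; last by exists (h * g).
split.
- split=> [|x y|r x].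
  + by apply/PE; rewrite mul0r.
  + by move=> /PE Jx /PE Jy; apply/PE; rewrite mulrDl; apply: ID.
  + by move=> /PE Jx; apply/PE; rewrite -mulrA; apply: IM.
- by move/PE; rewrite mul1r.
move=> a b /PE Iab; have [Pa|nPa] := classic (P a); [by left | right].
apply: (maxP (fun s => I (s * (a * h * g)))).
- exists (a * h) => //; by rewrite -mulrA => Ia; apply/nPa/PE.
- by move=> s /PE Is; rewrite -[a * h * g]mulrA mulrCA; apply: IM.
- by have -> : b * (a * h * g) = a * b * (h * g) by ring.
Qed.

End Noetherian.

(** * Symbolic powers *)

Section SymbolicPowers.
Local Open Scope ring_scope.
Variable R : idomainType.
Implicit Types (I P : R -> Prop).

(** Clearing denominators in the fraction field. *)
Lemma symb_powP I k g : symb_pow I k g <->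
  forall P, assoc_prime I P -> exists2 s, ~ P s & ideal_pow I k (s * g).
Proof.
have nz P s : assoc_prime I P -> ~ P s -> tofrac s != 0.
  move=> [[[P0 _ _] _ _] _] nPs; rewrite tofrac_eq0.
  by apply/eqP => s0; apply: nPs; rewrite s0.
split=> symg P assP.
  have [f [s [If nPs gE]]] := symg P assP; exists s => //.
  suff -> : s * g = f by [].
  by apply/eqP; rewrite -tofrac_eq tofracM gE mulrCA divff ?mulr1 ?(nz P).
have [s nPs Isg] := symg P assP; exists (s * g), s; split=> //.
by rewrite tofracM mulrAC divff ?mul1r ?(nz P).
Qed.

Lemma symb_pow_is_ideal I k : is_ideal (symb_pow I k).
Proof.
have [I0 ID IM] := ideal_pow_is_ideal I k.
split=> [|f g /symb_powP If /symb_powP Ig|r f /symb_powP If]; apply/symb_powP => P assP.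
- by exists 1; rewrite ?mulr0 //; case: assP => -[].
- have [[s nPs Isf] [t nPt Itg]] := (If P assP, Ig P assP).
  exists (s * t); first by case: assP => -[_ _ primeP] _ /primeP[].
  rewrite mulrDr [s * t]mulrC -mulrA; apply: ID; first exact: IM.
  by rewrite [t * s]mulrC -mulrA; apply: IM.
- have [s nPs Isf] := If P assP; exists s => //; rewrite mulrCA; exact: IM.
Qed.

Lemma symb_powM I k l f g :
  symb_pow I k f -> symb_pow I l g -> symb_pow I (k + l) (f * g).
Proof.
move=> /symb_powP If /symb_powP Ig; apply/symb_powP => P assP.
have [[s nPs Isf] [t nPt Itg]] := (If P assP, Ig P assP).
exists (s * t); first by case: assP => -[_ _ primeP] _ /primeP[].
by rewrite mulrACA; apply: ideal_powD.
Qed.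

Lemma symb_pow0 I f : symb_pow I 0 f.
Proof. by apply/symb_powP => P [[_ nP1 _] _]; exists 1. Qed.

(** The unit ideal has no associated prime. *)
Lemma symb_pow_unit I k f : I 1 -> is_ideal I -> symb_pow I k f.
Proof.
move=> I1 [_ _ IM] P [[_ nP1 _] [a Pa]]; case: nP1; apply/Pa.
by rewrite mul1r -[a]mulr1; apply: IM.
Qed.

Lemma sub_symb_pow1 I f : I f -> symb_pow I 1 f.
Proof.
move=> If; apply/symb_powP => P [[_ nP1 _] _]; exists 1 => //.
by rewrite mulrC; apply: ideal_mulI.
Qed.

End SymbolicPowers.

Section MonomialSymbolicPowers.
Local Open Scope ring_scope.
Variables (K : fieldType) (n : nat).
Local Notation S := {mpoly K[n]}.
Implicit Types (I : S -> Prop).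

Lemma symb_pow_has_monomials I k :
  has_monomials I -> has_monomials (symb_pow I k).
Proof.
move=> monI g m /symb_powP symg mg; apply/symb_powP => P assP.
have [s nPs Isg] := symg P assP; have [primeP _] := assP.
have monIk := ideal_pow_has_monomials (k := k) monI.
have [u nPu Iug] :=
  monomial_colon_witness (ideal_pow_is_ideal I k) monIk primeP nPs Isg.
exists 'X_[u] => //; rewrite -mpolyXD; apply: monIk Iug _.
by rewrite mulrC (perm_mem (msuppMX _ _)); apply: map_f.
Qed.

Lemma symb_pow1 I g : is_ideal I -> symb_pow I 1 g <-> I g.
Proof.
move=> idI; split=> [/symb_powP symg|]; last exact: sub_symb_pow1.
apply: NNPP => nIg; have [P assP Pcolon] := assoc_prime_exists idI nIg.
have [s nPs Isg] := symg P assP; apply/nPs/Pcolon.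
apply: Isg => // _ [a [b [Ia _ ->]]]; exact: idealMr.
Qed.

End MonomialSymbolicPowers.

(** * Monomial algebras and irreducible elements of monoids *)

Section MonomialAlgebras.
Local Open Scope ring_scope.
Variables (K : fieldType) (n : nat).
Local Notation S := {mpoly K[n]}.
Local Notation pair := ('X_{1..n} * nat)%type.
Implicit Types (E G H : pair -> Prop) (g h w : pair).

Definition padd g h : pair := ((g.1 + h.1)%MM, (g.2 + h.2)%N).
Definition pzero : pair := (0%MM, 0%N).
Definition pdeg g := (mdeg g.1 + g.2)%N.

Lemma pdegD g h : pdeg (padd g h) = (pdeg g + pdeg h)%N.
Proof. by rewrite /pdeg /= mdegD addnACA. Qed.

Lemma pdeg_eq0 g : pdeg g = 0%N -> g = pzero.
Proof.
case: g => u q /eqP; rewrite addn_eq0 /= mdeg_eq0 => /andP[/eqP-> /eqP->] //.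
Qed.

Lemma padd0 g : padd g pzero = g.
Proof. by case: g => u q; rewrite /padd /= addm0 addn0. Qed.

Lemma padd0g g : padd pzero g = g.
Proof. by case: g => u q; rewrite /padd /= add0m add0n. Qed.

Lemma paddA g h w : padd g (padd h w) = padd (padd g h) w.
Proof. by rewrite /padd /= addmA addnA. Qed.

Definition is_submonoid E := E pzero /\ forall g h, E g -> E h -> E (padd g h).

Inductive monoid_gen H : pair -> Prop :=
| MonoidGen0 : monoid_gen H pzero
| MonoidGenD h w : H h -> monoid_gen H w -> monoid_gen H (padd h w).

Lemma monoid_gen_submonoid H : is_submonoid (monoid_gen H).
Proof.
split=> [|g h]; first exact: MonoidGen0.
elim=> [|h' w Hh' _ IH] Hh; first by rewrite padd0g.
by rewrite -paddA; apply: MonoidGenD => //; apply: IH.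
Qed.

Lemma monoid_gen_sub E H : is_submonoid E -> (forall g, H g -> E g) ->
  forall g, monoid_gen H g -> E g.
Proof.
by move=> [E0 ED] HE g; elim=> [//|h w /HE Eh _ Ew]; apply: ED.
Qed.

Definition irreducible E g :=
  [/\ E g, g <> pzero &
      forall a b, E a -> E b -> g = padd a b -> a = pzero \/ b = pzero].

(** A splitting into nonzero summands lowers [pdeg], the total degree in the
    variables and t. *)
Lemma irreducibles_generate E g : E g -> monoid_gen (irreducible E) g.
Proof.
have [N] := ubnP (pdeg g); elim: N g => // N IH g leN Eg.
have [->|nz] := classic (g = pzero); first exact: MonoidGen0.
have [irr|nirr] := classic (irreducible E g).
  by rewrite -[g]padd0; apply: MonoidGenD => //; apply: MonoidGen0.
have [a [b [Ea Eb gE nza nzb]]] :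
    exists a b, [/\ E a, E b, g = padd a b, a <> pzero & b <> pzero].
  apply: NNPP => nsplit; apply: nirr; split=> // a b Ea Eb gE.
  have [->|nza] := classic (a = pzero); first by left.
  have [->|nzb] := classic (b = pzero); first by right.
  by case: nsplit; exists a, b.
have pos c : c <> pzero -> (0 < pdeg c)%N.
  by move=> nzc; rewrite lt0n; apply/eqP => /pdeg_eq0.
rewrite gE; apply: (monoid_gen_submonoid _).2; apply: IH => //.
all: by move: leN (pos _ nza) (pos _ nzb); rewrite gE pdegD; lia.
Qed.

(** In a decomposition of an irreducible element into elements of H, all the
    summands but one are zero. *)
Lemma irreducible_in_generators E H : is_submonoid E ->
  (forall g, H g -> E g) -> forall g, irreducible E g -> monoid_gen H g -> H g.
Proof.
move=> subE HE g [Eg nzg irrg] genHg; move: genHg Eg nzg irrg.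
elim=> [//|h w Hh genHw IH] Ehw nzhw irrhw.
have Ew : E w by apply: monoid_gen_sub genHw.
case: (irrhw h w (HE h Hh) Ew erefl) => [h0|->]; last by rewrite padd0.
rewrite h0 padd0g in Ehw nzhw irrhw *; exact: IH.
Qed.

(** The K-span of the monomials X^m t^k with (m, k) in E. *)
Definition mon_algebra E : {poly S} -> Prop :=
  fun p => forall k m, m \in msupp p`_k -> E (m, k).

Lemma mon_algebra_subalg E : is_submonoid E -> is_subalg (mon_algebra E).
Proof.
move=> [E0 ED]; split=> [c|p r Ep Er|p r Ep Er] k m.
- rewrite coefC; case: eqP => [->|_]; last by rewrite -mpolyC0 msupp0.
  by rewrite msuppC; case: ifP => // _; rewrite inE => /eqP->.
- by rewrite coefD => /msuppD_le; rewrite mem_cat => /orP[/Ep|/Er].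
rewrite coefM => /msupp_sum_le/flatten_mapP[i _].
move/msuppM_le/allpairsP=> [[u v] /= [up vr ->]].
by have := ED _ _ (Ep _ _ up) (Er _ _ vr); rewrite /padd /= subnKC // -ltnS.
Qed.

Lemma mon_algebra_monomial E g : mon_algebra E ('X_[g.1] *: 'X^(g.2)) <-> E g.
Proof.
case: g => u q /=; split=> [/(_ q u)|Eg k m].
  by rewrite coefZ coefXn eqxx mulr1 msuppX inE eqxx => /(_ isT).
rewrite coefZ coefXn; case: eqP => [->|_]; last by rewrite mulr0 -mpolyC0 msupp0.
by rewrite mulr1 => /mem_msuppXP <-.
Qed.

Lemma mon_subalg_gen_subalg G : is_subalg (@mon_subalg_gen K n G).
Proof.
split=> [c|p r genp genr|p r genp genr] B subB GB; have [BC BD BM] := subB.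
- exact: BC.
- by apply: BD; [apply: genp | apply: genr].
- by apply: BM; [apply: genp | apply: genr].
Qed.

Lemma mon_subalg_genE G p : mon_subalg_gen G p <-> mon_algebra (monoid_gen G) p.
Proof.
split=> [genp|monp].
  apply: genp; first exact/mon_algebra_subalg/monoid_gen_submonoid.
  move=> g Gg; apply/mon_algebra_monomial.
  by rewrite -[g]padd0; apply: MonoidGenD => //; apply: MonoidGen0.
have [genC genD genM] := mon_subalg_gen_subalg G.
have gen_monomial g : monoid_gen G g -> mon_subalg_gen G ('X_[K, g.1] *: 'X^(g.2)).
  elim=> [|h w Gh _ genw].
    by have := genC 1; rewrite /= mpolyX0 scale1r expr0 mpolyC1 polyC1.
  have -> : 'X_[(padd h w).1] *: 'X^((padd h w).2) =
      ('X_[K, h.1] *: 'X^(h.2)) * ('X_[w.1] *: 'X^(w.2)) :> {poly S}.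
    by rewrite -scalerAl -scalerAr scalerA -exprD -mpolyXD.
  by apply: genM => // B _; apply.
have gen0 : mon_subalg_gen G (0 : {poly S}).
  by have := genC 0; rewrite mpolyC0 polyC0.
rewrite -[p]coefK poly_def; elim/big_ind: _ => // i _.
rewrite [p`_i]mpolyE scaler_suml big_seq; elim/big_ind: _ => // m mp.
rewrite -mul_mpolyC -scalerA -mul_polyC.
by apply: genM; [apply: genC | apply: (gen_monomial (m, nat_of_ord i)); apply: monp].
Qed.

End MonomialAlgebras.

Arguments pzero {n}.

(** * Minimal generators of a monomial ideal and of its Rees algebra *)

Section MinimalGenerators.
Local Open Scope ring_scope.
Variables (K : fieldType) (n : nat) (I : {mpoly K[n]} -> Prop).
Hypothesis idI : is_ideal I.
Hypothesis monI : has_monomials I.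
Local Notation S := {mpoly K[n]}.
Local Notation pair := ('X_{1..n} * nat)%type.
Implicit Types (u v : 'X_{1..n}) (g h : pair).

Definition minimal_monomial u :=
  I 'X_[u] /\ forall v, I 'X_[v] -> (v <= u)%MM -> v = u.

Lemma mdeg_le_eq v u : (v <= u)%MM -> (mdeg u <= mdeg v)%N -> v = u.
Proof.
move=> levu ledeg; have /eqP : mdeg (u - v) = 0%N.
  by have := congr1 mdeg (submK levu); rewrite mdegD; lia.
by rewrite mdeg_eq0 => /eqP duv; rewrite -(submK levu) duv add0m.
Qed.

Lemma minimal_monomial_below v : I 'X_[v] ->
  exists2 u, minimal_monomial u & (u <= v)%MM.
Proof.
have [N] := ubnP (mdeg v); elim: N v => // N IH v leN Iv.
have [minv|nmin] := classic (minimal_monomial v).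
  by exists v; rewrite ?lepm_refl.
have [w [Iw lewv nwv]] : exists w, [/\ I 'X_[w], (w <= v)%MM & w <> v].
  apply: NNPP => now; apply: nmin; split=> // w Iw lewv.
  by apply: NNPP => nwv; apply: now; exists w.
have ltwv : (mdeg w < mdeg v)%N.
  by rewrite ltnNge; apply/negP => /(mdeg_le_eq lewv).
have [|u minu leuw] := IH w _ Iw; first exact: leq_trans ltwv leN.
by exists u => //; apply: lepm_trans lewv.
Qed.

Lemma min_genE u : min_gen I u <-> minimal_monomial u.
Proof.
apply: minimal_set_least => {u} [f|M genM u [Iu minu]].
  split=> [/mon_ideal_genP minf|If].
    apply: ideal_of_msupp => // m /minf [u [Iu _] leum]; exact: ideal_lem leum Iu.
  by apply/mon_ideal_genP => m mf; apply: minimal_monomial_below; apply: monI mf.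
have /genM/mon_ideal_genP/(_ u) := Iu; rewrite msuppX inE eqxx => -[//|v Mv levu].
rewrite -(minu v) //; apply/genM => J _; apply; by exists v.
Qed.

Lemma min_gen_exists : nonzero_ideal I -> exists u, min_gen I u.
Proof.
case=> f If nzf; have [u minu _] := minimal_monomial_below (monI If (mlead_supp nzf)).
by exists u; apply/min_genE.
Qed.

Lemma omega_attained : nonzero_ideal I ->
  exists2 u, min_gen I u & mdeg u = omega I.
Proof.
move=> nzI; have [u0 minu0] := min_gen_exists nzI.
have [|b le_b] := @antichain_mdeg_bounded n (min_gen I).
  by move=> u v /min_genE[Iu _] /min_genE[_ minv] leuv; apply: minv.
have [||w maxw] := @bounded_is_max (fun e => exists2 u, min_gen I u & e = mdeg u) b.
- by exists (mdeg u0), u0.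
- by move=> _ [u minu ->]; apply: le_b.
rewrite /omega (nat_max_eq maxw); have [[u minu ->] _] := maxw.
by exists u.
Qed.

Definition rees_monoid : pair -> Prop := fun g => symb_pow I g.2 'X_[g.1].

Lemma rees_monoid_submonoid : is_submonoid rees_monoid.
Proof.
split=> [|g h Ig Ih]; first exact: symb_pow0.
by rewrite /rees_monoid /= mpolyXD; apply: symb_powM.
Qed.

Lemma symb_reesE p : symb_rees I p <-> mon_algebra rees_monoid p.
Proof.
split=> [symp k m mp|monp k]; first exact: symb_pow_has_monomials mp.
by apply: ideal_of_msupp (monp k); apply: symb_pow_is_ideal.
Qed.

Lemma gens_reesE G :
  gens_rees I G <-> (forall g, monoid_gen G g <-> rees_monoid g).
Proof.
split=> [genG g|EG p].
  have := genG ('X_[g.1] *: 'X^(g.2)).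
  by rewrite mon_subalg_genE symb_reesE !mon_algebra_monomial.
rewrite mon_subalg_genE symb_reesE.
by split=> monp k m /monp/EG.
Qed.

Lemma rees_min_genE g : rees_min_gen I g <-> irreducible rees_monoid g.
Proof.
apply: minimal_set_least => {g} [|H /gens_reesE HE g irrg].
  apply/gens_reesE => g; split; last exact: irreducibles_generate.
  by apply: monoid_gen_sub; [exact: rees_monoid_submonoid | move=> h []].
have HE_sub h : H h -> rees_monoid h.
  by move=> Hh; apply/HE; rewrite -[h]padd0; apply: MonoidGenD => //; apply: MonoidGen0.
apply: (irreducible_in_generators rees_monoid_submonoid HE_sub irrg).
by apply/HE; case: irrg.
Qed.

(** In a decomposition of (u, 1), one factor (v, 1) has t-degree one, and
    v is in I^(1) = I; as v divides u, minimality of u makes the other factor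
    trivial. *)
Lemma min_gen_rees_min_gen u : min_gen I u -> rees_min_gen I (u, 1%N).
Proof.
move=> /min_genE [Iu minu]; apply/rees_min_genE; split=> //.
  exact: sub_symb_pow1.
have deg1 a b : rees_monoid a -> (u, 1%N) = padd a b -> a.2 = 1%N -> b = pzero.
  case: a b => [v p] [w q] Iv; rewrite /padd /= => -[uE qE] p1.
  rewrite p1 in Iv qE; have {}q0 : q = 0%N by lia.
  have {}Iv : I 'X_[v] by apply/(symb_pow1 _ idI).
  have vu : v = u by apply: minu => //; rewrite uE lem_addr.
  rewrite q0 /pzero; congr (_, _); apply: (@addmI _ v).
  by rewrite -uE addm0.
move=> a b Ea Eb ab; have [a1|a1] := eqVneq a.2 1%N.
  by right; apply: deg1 ab a1.
left; apply: (deg1 b) => //.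
  by rewrite ab /padd addmC addnC.
by move: ab a1 => [_]; lia.
Qed.

End MinimalGenerators.

Theorem proposition1p4 (K : fieldType) (n : nat) (I : {mpoly K[n]} -> Prop)
    (monI : monomial_ideal I) (nzI : nonzero_ideal I)
    (degI : forall (u : 'X_{1..n}) (q : nat),
      rees_min_gen I (u, q) -> 0 < q -> mdeg u <= q + omega I - 1) :
  forall k : nat, 1 <= k -> d I k = omega I * k.
Proof.
move=> k _; have idI := monomial_ideal_is_ideal monI.
have {}monI := monomial_ideal_has_monomials monI.
have [u0 minu0 deg_u0] := omega_attained idI monI nzI.
have deg_le u q : rees_min_gen I (u, q) -> 0 < q -> mdeg u <= omega I * q.
  have [w0|w_gt0] := posnP (omega I); last by move=> /degI bound /[dup] /bound; nia.
  (* A generator of degree zero is 1, so I is the unit ideal. *)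
  have u0E : u0 = 0%MM by apply/eqP; rewrite -mdeg_eq0 deg_u0 w0.
  have I1 : I 1%R.
    by move/(min_genE idI monI): minu0 => -[+ _]; rewrite u0E mpolyX0.
  move=> /(rees_min_genE monI) [_ _ irr] q_gt0; rewrite w0 mul0n leqn0.
  (* Every monomial is in the algebra, and u t^q is the product of u and t^q. *)
  have [|||[u_eq0]|[q_eq0]] := irr (u, 0) (0%MM, q).
  - exact: symb_pow_unit.
  - exact: symb_pow_unit.
  - by rewrite /padd /= addm0.
  - by rewrite u_eq0 mdeg0.
  - by rewrite q_eq0 in q_gt0.
apply: nat_max_eq; split=> [|_ [s [c [uniq_s min_s sum_k ->]]]].
  exists [:: (u0, 1)], (fun=> k); rewrite !big_seq1 /= muln1 deg_u0 mulnC.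
  split=> // g; rewrite inE => /eqP->; split=> //.
  exact: min_gen_rees_min_gen.
apply: leq_trans (leq_mul (leqnn (omega I)) sum_k).
rewrite big_distrr /= big_seq [leqRHS]big_seq; apply: leq_sum => -[u q] gs.
have [ming q_gt0] := min_s _ gs.
by rewrite mulnCA leq_mul2l deg_le ?orbT.
Qed.
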